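(* Let $\alpha>-1$, $\beta\in\mathbb{R}$, $k^2\in(0,1)$, and let $\beta_n$ and $\mathsf{p}_1(n)$ be the recurrence coefficients and sub-leading coefficients of the monic polynomials orthogonal with respect to $w(x,k^2)=(1-x^2)^{\alpha}(1-k^2x^2)^{\beta}$ on $[-1,1]$. Then for every $n\ge 1$, $$\begin{aligned} 0={}&k^2[\mathsf{p}_1(n)]^2+\Big[2k^2\big(\alpha+\beta+n-\tfrac12\big)\beta_n-\alpha k^2-\beta\Big]\mathsf{p}_1(n)-k^2\big(\alpha+\beta+n+\tfrac32\big)\big(\alpha+\beta+n-\tfrac12\big)\beta_n^2\\ &-\Big[k^2\big(\alpha+\beta+n+\tfrac32\big)\big(\alpha+\beta+n-\tfrac12\big)\beta_{n+1}-\Big\{\big(\beta+n+\tfrac12\big)k^2+\big(\alpha+n+\tfrac12\big)\Big\}\big(\alpha+\beta+n-\tfrac12\big)\\ &\qquad+k^2\big(\alpha+\beta+n+\tfrac12\big)\big(\alpha+\beta+n-\tfrac32\big)\beta_{n-1}\Big]\beta_n-\frac n2\Big(\frac n2+\alpha+\beta\Big). \end{aligned}$$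
   Context: For $\alpha>-1$, $\beta\in\mathbb{R}$, $k^2\in(0,1)$, the weight is $w(x,k^2)=(1-x^2)^{\alpha}(1-k^2x^2)^{\beta}$, $x\in[-1,1]$. For $n\ge0$, $P_n$ is the monic polynomial of degree $n$ with $\int_{-1}^1 P_i(x)P_j(x)w(x,k^2)\,dx=h_j\delta_{i,j}$. As $w$ is even, $P_n(x)=x^n+\mathsf{p}_1(n)x^{n-2}+\dots+P_n(0)$, with $\mathsf{p}_1(0)=\mathsf{p}_1(1):=0$. The recurrence coefficients $\beta_n$ (with an index; $\beta$ without index is the exponent) are defined by $xP_n(x)=P_{n+1}(x)+\beta_nP_{n-1}(x)$, with $P_{-1}:=0$, $\beta_0:=0$; thus $\beta_n=h_n/h_{n-1}$ for $n\ge1$. *)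

(* Defs.v *)
From HB Require Import structures.
From mathcomp Require Import all_boot all_order all_algebra.
From mathcomp Require Import all_classical all_reals all_analysis.

Set Implicit Arguments.
Unset Strict Implicit.
Unset Printing Implicit Defensive.

Import Order.TTheory GRing.Theory Num.Theory.
Import numFieldNormedType.Exports.

Local Open Scope classical_set_scope.
Local Open Scope ring_scope.

(* [powR] takes the value 0 at base 0 for every nonzero exponent, so for
   alpha < 0 the weight is 0, and not +oo, at x = -1 and x = 1; these two
   points are negligible for the Lebesgue measure. *)
Definition weight (R : realType) (alpha beta k x : R) : R :=
  (1 - x ^+ 2) `^ alpha * (1 - k ^+ 2 * x ^+ 2) `^ beta.

Definition monic_orthogonal (R : realType) (w : R -> R)
    (P : nat -> {poly R}) (h : nat -> R) : Prop :=
  (forall n, P n \is monic /\ size (P n) = n.+1) /\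
  (forall i j,
     (\int[@lebesgue_measure R]_(x in `[(-1)%R, 1%R])
        ((P i).[x] * (P j).[x] * w x)%:E = (h j * (i == j)%:R)%:E)%E).

(* The convention P_{-1} = 0. *)
Definition pred_poly (R : realType) (P : nat -> {poly R}) (n : nat) : {poly R} :=
  if n is m.+1 then P m else 0.

Definition recurrence_coeffs (R : realType) (P : nat -> {poly R})
    (b : nat -> R) : Prop :=
  b 0%N = 0 /\ forall n, 'X * P n = P n.+1 + b n *: pred_poly P n.

(* The coefficient of x^(n-2); the case split is needed because n - 2 is
   truncated on [nat]. *)
Definition subleading (R : realType) (P : nat -> {poly R}) (n : nat) : R :=
  if (n < 2)%N then 0 else (P n)`_(n - 2).

(* Main.v *)
Require Import Defs.
From HB Require Import structures.
From mathcomp Require Import all_boot all_order all_algebra.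
From mathcomp Require Import all_classical all_reals all_analysis.
From mathcomp Require Import measurable_realfun.
From mathcomp Require Import ring lra zify.

Set Implicit Arguments.
Unset Strict Implicit.
Unset Printing Implicit Defensive.

Import Order.TTheory GRing.Theory Num.Theory.
Import numFieldNormedType.Exports.

Local Open Scope classical_set_scope.
Local Open Scope ring_scope.

(** Write [q] for [k ^+ 2], [sigma = (1 - x^2)(1 - q x^2)] and
    [v = - sigma w' / w], an odd polynomial of degree at most 3. The proof is
    algebraic except for one fact about the weight [w], a Pearson equation in
    weak form: for every polynomial [p],
      [\int (sigma p' + (sigma' - v) p) w = 0],
    because the integrand is the derivative of [p sigma w], which vanishes at
    both endpoints since [alpha + 1 > 0] ([weighted_integral_pearson]).

    Hence [sigma (P n)'], expanded in the orthogonal basis, involves only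
    [P (n+3)], ..., [P (n-3)], which the recurrence folds into the ladder
    relation ([ladder_relation])
      [sigma (P n)' = b_n A_n P_(n-1) - B_n P_n],
    where [A_n = a0 + a2 x^2] and [B_n = b1 x - n q x^3] have coefficients that
    are explicit in [b_n], [b_(n+1)] and the subleading coefficient [p1 n].
    Eliminating [P_(n-2)] from the relation at [n-1] gives its companion
      [sigma (P (n-1))' = (B_n + v) P_(n-1) - A_(n-1) P_n].

    At a root of [sigma] the two relations form a homogeneous linear system for
    the values of [P n] and [P (n-1)]. These do not vanish together, because
    [b_n = h_n / h_(n-1)] is nonzero and the recurrence would carry a common
    zero down to [P 0 = 1]. The determinant is therefore zero
    ([ladder_compatibility_at_root]):
      [B_n (B_n + v) = b_n A_n A_(n-1)] at [x^2 = 1] and at [x^2 = 1 / q].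
    The difference of these two equations, divided by [4 (1 - q)], is the
    claimed identity: the product [b_(n+1) b_(n-1)] cancels and [p1 n] enters
    quadratically ([quadratic_relation]). *)

(** * Parity of polynomials *)

Section Parity.
Variable R : idomainType.
Implicit Types p q : {poly R}.

Definition has_parity (e : bool) p := forall i, odd i != e -> p`_i = 0.

Lemma has_parityD e p q :
  has_parity e p -> has_parity e q -> has_parity e (p + q).
Proof. by move=> hp hq i ie; rewrite coefD hp ?hq ?addr0. Qed.

Lemma has_parityN e p : has_parity e p -> has_parity e (- p).
Proof. by move=> hp i ie; rewrite coefN hp ?oppr0. Qed.

Lemma has_parityB e p q :
  has_parity e p -> has_parity e q -> has_parity e (p - q).
Proof. by move=> hp hq; apply/has_parityD/has_parityN. Qed.

Lemma has_parityM e1 e2 p q :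
  has_parity e1 p -> has_parity e2 q -> has_parity (e1 (+) e2) (p * q).
Proof.
move=> hp hq i ie; rewrite coefM big1// => -[j /= ji] _.
have [je|je] := eqVneq (odd j) e1; last by rewrite hp ?mul0r.
rewrite hq ?mulr0// oddB// je; apply: contra ie => /eqP <-.
by rewrite addbCA addbb addbF.
Qed.

Lemma has_parityC c : has_parity false c%:P.
Proof. by case=> // i _; rewrite coefC. Qed.

Lemma has_parityXn n : has_parity (odd n) 'X^n.
Proof. by move=> i; rewrite coefXn; case: (i =P n) => [->|]; rewrite ?eqxx. Qed.

Lemma has_parityX : has_parity true 'X.
Proof. exact: (@has_parityXn 1). Qed.

Lemma has_parity_deriv e p : has_parity e p -> has_parity (~~ e) p^`().
Proof.
move=> hp i ie; rewrite coef_deriv hp ?mul0rn//=.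
by apply: contra ie => /eqP <-; rewrite negbK.
Qed.

End Parity.

(** * Polynomials orthogonal for an even functional *)

(** The integral against the weight enters only as a linear functional [L]. Its
    evenness is encoded in the recurrence, which has no diagonal term. *)
Section OrthogonalPolynomials.
Variables (R : realType) (L : {poly R} -> R) (P : nat -> {poly R}).
Variables (h b : nat -> R).
Hypothesis L_linear : forall c p q, L (c *: p + q) = c * L p + L q.
Hypothesis P_monic : forall n, P n \is monic.
Hypothesis P_size : forall n, size (P n) = n.+1.
Hypothesis P_orth : forall i j, L (P i * P j) = h j * (i == j)%:R.
Hypothesis h_neq0 : forall n, h n != 0.
Hypothesis P_rec : recurrence_coeffs P b.

Let LD p q : L (p + q) = L p + L q.
Proof. by have := L_linear 1 p q; rewrite scale1r mul1r. Qed.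

Let L0 : L 0 = 0.
Proof. by have /eqP := LD 0 0; rewrite addr0 -subr_eq subrr eq_sym => /eqP. Qed.

Let LZ c p : L (c *: p) = c * L p.
Proof. by have := L_linear c p 0; rewrite !addr0 L0 addr0. Qed.

Lemma coefP_top n : (P n)`_n = 1.
Proof. by have /monicP := P_monic n; rewrite lead_coefE P_size. Qed.

Lemma coefP_gt n i : (n < i)%N -> (P n)`_i = 0.
Proof. by move=> ni; rewrite nth_default// P_size. Qed.

Lemma P0E : P 0 = 1.
Proof.
apply/polyP => -[|i]; first by rewrite coefP_top coefC.
by rewrite coefP_gt// coefC.
Qed.

Lemma P1E : P 1 = 'X.
Proof. by have [b0 /(_ 0%N)] := P_rec; rewrite P0E b0 scale0r addr0 mulr1. Qed.

Lemma P_recS n : 'X * P n.+1 = P n.+2 + (b n.+1)%:P * P n.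
Proof. by rewrite mul_polyC; apply: P_rec.2. Qed.

Lemma has_parityP n : has_parity (odd n) (P n).
Proof.
suff: has_parity (odd n) (P n) /\ has_parity (~~ odd n) (P n.+1) by case.
elim: n => [|n [IH1 IH2]].
  by rewrite P0E P1E; split; [exact: has_parityC|exact: has_parityX].
split=> //=; rewrite negbK.
have -> : P n.+2 = 'X * P n.+1 - (b n.+1)%:P * P n.
  by rewrite P_recS addrK.
apply: has_parityB.
  by have := has_parityM (@has_parityX R) IH2; rewrite addTb negbK.
exact: (has_parityM (@has_parityC R _) IH1).
Qed.

Local Notation p1 := (subleading P).

Lemma subleadingS n : p1 n.+1 = p1 n - b n.
Proof.
rewrite /subleading; case: n => [|n].
  by rewrite /= P_rec.1 subrr.
rewrite ltnS/= subn2/=.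
have /(congr1 (fun p : {poly R} => p`_n)) := P_recS n.
rewrite coefXM coefD coefCM coefP_top mulr1.
case: n => [|n] /=; first by move/eqP; rewrite eq_sym addr_eq0 sub0r => /eqP.
by rewrite subSS subn1/= => ->; rewrite addrK.
Qed.

Lemma L_orth_low n (p : {poly R}) : (size p <= n)%N -> L (P n * p) = 0.
Proof.
elim: {1 3}n (leqnn n) p => [|m IH] mn p.
  by rewrite leqn0 size_poly_eq0 => /eqP ->; rewrite mulr0 L0.
move=> sp; rewrite -[p](subrK (p`_m *: P m)) mulrDr LD IH ?(ltnW mn)//.
  by rewrite -scalerAr LZ P_orth gtn_eqF// !mulr0 addr0.
apply/leq_sizeP => j; rewrite leq_eqVlt => /predU1P[<-|mj].
  by rewrite coefB coefZ coefP_top mulr1 subrr.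
by rewrite coefB coefZ coefP_gt// mulr0 subr0 nth_default// (leq_trans sp).
Qed.

(** Subtracting from [p] its components along [P n.+2], [P n.+1] and [P n]
    leaves degree below [n]; by parity [P n.+1] does not contribute to the
    coefficient of degree [n], and [P n.+2] contributes [p1 n.+2]. Thus two
    coefficients of [p] decide the pairing, with no expansion in the basis. *)
Lemma L_orth_top n (p : {poly R}) : (size p <= n.+3)%N ->
  L (P n * p) = h n * (p`_n - p`_n.+2 * p1 n.+2).
Proof.
move=> sp; set c := p`_n - _.
pose r := p - p`_n.+2 *: P n.+2 - p`_n.+1 *: P n.+1 - c *: P n.
have Ep : p = c *: P n + (p`_n.+1 *: P n.+1 + (p`_n.+2 *: P n.+2 + r)).
  by rewrite /r -!mul_polyC; ring.
suff r_small : (size r <= n)%N.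
  move: (L_orth_low r_small); rewrite {1}Ep; clearbody c r => r0.
  rewrite !mulrDr !LD -!scalerAr !LZ !P_orth eqxx !ltn_eqF// r0.
  by rewrite !mulr0 !addr0 mulr1 mulrC.
have odd_coef : (P n.+1)`_n = 0 by apply: has_parityP => /=; case: odd.
have odd_coef2 : (P n.+2)`_n.+1 = 0 by apply: has_parityP => /=; case: odd.
have p1E : p1 n.+2 = (P n.+2)`_n by rewrite /subleading ltnNge /= subn2.
apply/leq_sizeP => j; rewrite /r !(coefB, coefZ).
have [nj|] := ltnP n.+2 j.
  move=> _; have gt m : (m <= n.+2)%N -> (P m)`_j = 0.
    by move=> mn; apply: coefP_gt; exact: leq_ltn_trans nj.
  rewrite (gt n.+2 (leqnn _)) (gt n.+1 (leqnSn _)) (gt n (leqW (leqnSn n))).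
  by rewrite nth_default ?(leq_trans sp)// !mulr0 !subr0.
rewrite leq_eqVlt => /predU1P[->|].
  by rewrite coefP_top !coefP_gt// !mulr0 mulr1 subrr !subr0.
rewrite ltnS leq_eqVlt => /predU1P[->|].
  by rewrite odd_coef2 coefP_top coefP_gt// !mulr0 mulr1 !subr0 subrr.
rewrite ltnS => jn nj; have {jn nj} -> : j = n by lia.
rewrite coefP_top odd_coef !mulr0 mulr1 subr0 -p1E /c; ring.
Qed.

Lemma recurrence_coeff_norms n : b n.+1 * h n = h n.+1.
Proof.
have := P_orth n.+1 n.+1; rewrite eqxx mulr1 => <-.
rewrite -[X in P n.+1 * X](subrK ('X * P n)) mulrDr LD L_orth_low.
  rewrite add0r mulrCA mulrA P_recS mulrDl LD P_orth gtn_eqF//.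
  by rewrite mulr0 add0r -mulrA mul_polyC LZ P_orth eqxx mulr1.
apply/leq_sizeP => j; rewrite leq_eqVlt coefB coefXM => /predU1P[<-|nj].
  by rewrite !coefP_top subrr.
by rewrite coefP_gt//; case: j nj => //= j nj; rewrite coefP_gt// subr0.
Qed.

Lemma recurrence_coeff_neq0 n : b n.+1 != 0.
Proof.
by have := h_neq0 n.+1; rewrite -recurrence_coeff_norms mulf_eq0 => /norP[].
Qed.

Lemma consecutive_no_common_root n x : (P n).[x] = 0 -> (P n.+1).[x] != 0.
Proof.
elim: n => [|n IH]; first by rewrite P0E hornerC => /eqP; rewrite oner_eq0.
move=> Pn; apply/eqP => Pn1.
have /(congr1 (fun p : {poly R} => p.[x])) := P_recS n.
rewrite !hornerE Pn Pn1 mulr0 add0r => /esym/eqP.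
by rewrite mulf_eq0 (negPf (recurrence_coeff_neq0 n)) => /eqP/IH/eqP; apply.
Qed.

Lemma orthogonal_to_low_eq0 n (p : {poly R}) : (size p <= n)%N ->
  (forall m, (m < n)%N -> L (p * P m) = 0) -> p = 0.
Proof.
elim: n => [|n IH] sp pP.
  by apply/eqP; rewrite -size_poly_eq0 -leqn0.
pose q := p - p`_n *: P n.
have size_q : (size q <= n)%N.
  apply/leq_sizeP => j; rewrite /q coefB coefZ leq_eqVlt => /predU1P[<-|nj].
    by rewrite coefP_top mulr1 subrr.
  by rewrite coefP_gt// mulr0 subr0 nth_default// (leq_trans sp).
have Ep : p = p`_n *: P n + q by rewrite /q addrC subrK.
have pn0 : p`_n = 0.
  have := pP n (leqnn _); move: (L_orth_low size_q); rewrite mulrC.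
  rewrite {1}Ep; clearbody q => q0; rewrite mulrDl LD -scalerAl LZ P_orth q0.
  rewrite eqxx mulr1 addr0 => /eqP.
  by rewrite mulf_eq0 (negPf (h_neq0 n)) orbF => /eqP.
apply: IH => [|m mn]; last by apply: pP; rewrite ltnW.
by rewrite Ep pn0 scale0r add0r.
Qed.

(** * First-order operators and the ladder relation *)

Lemma coef_X3P m : ('X^3 * P m)`_m.+1 = p1 m.
Proof. by rewrite coefXnM /subleading ltnS; case: m => [|[|m]]. Qed.

Lemma coef_X2P m : ('X^2 * P m)`_m = p1 m.
Proof. by rewrite coefXnM /subleading. Qed.

Lemma coef_X2_derivP m : ('X^2 * (P m)^`())`_m.+1 = m%:R.
Proof.
rewrite coefXnM; case: m => [|m] //=.
by rewrite subSS subn1/= coef_deriv coefP_top.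
Qed.

Lemma coef_X4_derivP_top m : ('X^4 * (P m)^`())`_m.+3 = m%:R.
Proof.
rewrite coefXnM; case: m => [|m] //=.
by rewrite !subSS subn0 coef_deriv coefP_top.
Qed.

(** For [m < 2] both sides vanish because [p1 m = 0]; the factor [m - 2] is
    therefore taken in [R], free of truncation. *)
Lemma coef_X4_derivP m : ('X^4 * (P m)^`())`_m.+1 = (m%:R - 2) * p1 m.
Proof.
rewrite coefXnM /subleading; case: m => [|[|[|m]]] //=; rewrite ?mulr0//.
  by rewrite subrr mul0r.
rewrite !subSS !subn0 coef_deriv -[LHS]mulr_natl; congr (_ * _).
by rewrite -[m.+3]addn2 natrD addrK.
Qed.

(** For [s = 1 + q] the factor of [p^`()] is [sigma = (1 - x^2)(1 - q x^2)]. The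
    Pearson equation and the ladder relation differ only in the odd cubic
    [x1 x + x3 x^3], so one operator serves for both. *)
Definition first_order_op (s q x1 x3 : R) (p : {poly R}) : {poly R} :=
  (1 - s%:P * 'X^2 + q%:P * 'X^4) * p^`() + (x1%:P * 'X + x3%:P * 'X^3) * p.

Lemma first_order_opE s q x1 x3 p : first_order_op s q x1 x3 p =
  p^`() - s%:P * ('X^2 * p^`()) + q%:P * ('X^4 * p^`())
  + x1%:P * ('X * p) + x3%:P * ('X^3 * p).
Proof. by rewrite /first_order_op; ring. Qed.

Lemma coef_first_order_op_top s q x1 x3 m :
  (first_order_op s q x1 x3 (P m))`_m.+3 = m%:R * q + x3.
Proof.
rewrite first_order_opE !(coefD, coefN, coefCM) coef_X4_derivP_top coefXM.
rewrite !coefXnM/= !subSS !subn0 !coef_deriv coefP_top !coefP_gt//.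
by rewrite !mul0rn; ring.
by apply: ltnW; rewrite !ltnS leqW.
Qed.

Lemma coef_first_order_op s q x1 x3 m :
  (first_order_op s q x1 x3 (P m))`_m.+1 =
  - s * m%:R + q * (m%:R - 2) * p1 m + x1 + x3 * p1 m.
Proof.
rewrite first_order_opE !(coefD, coefN, coefCM).
rewrite coef_X4_derivP coef_X2_derivP coef_X3P coefXM/= coefP_top.
by rewrite coef_deriv coefP_gt// mul0rn; ring.
Qed.

Lemma size_first_order_op s q x1 x3 m :
  (size (first_order_op s q x1 x3 (P m)) <= m.+4)%N.
Proof.
have cP j : (m < j)%N -> (P m)`_j = 0 by exact: coefP_gt.
apply/leq_sizeP => j mj.
rewrite first_order_opE !(coefD, coefN, coefCM) coefXM !coefXnM.
case: j mj => [|[|[|[|j]]]] //= mj.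
rewrite !subSS !subn0 !coef_deriv !cP ?mul0rn ?mulr0 ?addr0 ?subr0//; lia.
Qed.

Lemma parity_first_order_op s q x1 x3 m :
  has_parity (~~ odd m) (first_order_op s q x1 x3 (P m)).
Proof.
have hP := @has_parityP m; have hP' := has_parity_deriv hP.
have hX n e (p : {poly R}) :
    has_parity e p -> has_parity (odd n (+) e) ('X^n * p).
  by move=> hp; apply: has_parityM => //; exact: has_parityXn.
have hC c e (p : {poly R}) : has_parity e p -> has_parity e (c%:P * p).
  by move=> hp; apply: (has_parityM (@has_parityC R c) hp).
rewrite first_order_opE -[X in _ * (X * P m)]expr1.
apply: has_parityD; last by apply: hC; exact: (hX 3%N _ _ hP).
apply: has_parityD; last by apply: hC; exact: (hX 1%N _ _ hP).
apply: has_parityD; last by apply: hC; exact: (hX 4%N _ _ hP').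
by apply: has_parityB => //; apply: hC; exact: (hX 2%N _ _ hP').
Qed.

Definition quadratic_op (a0 a2 : R) (p : {poly R}) : {poly R} :=
  (a0%:P + a2%:P * 'X^2) * p.

Lemma quadratic_opE a0 a2 p :
  quadratic_op a0 a2 p = a0%:P * p + a2%:P * ('X^2 * p).
Proof. by rewrite /quadratic_op; ring. Qed.

Lemma coef_quadratic_op_top a0 a2 m :
  (quadratic_op a0 a2 (P m))`_m.+2 = a2.
Proof.
rewrite quadratic_opE coefD !coefCM coefXnM/= !subSS subn0 coefP_top coefP_gt//.
by rewrite mulr0 add0r mulr1.
Qed.

Lemma coef_quadratic_op a0 a2 m :
  (quadratic_op a0 a2 (P m))`_m = a0 + a2 * p1 m.
Proof. by rewrite quadratic_opE coefD !coefCM coef_X2P coefP_top mulr1. Qed.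

Lemma size_quadratic_op a0 a2 m : (size (quadratic_op a0 a2 (P m)) <= m.+3)%N.
Proof.
apply/leq_sizeP => j mj; rewrite quadratic_opE coefD !coefCM coefXnM.
case: j mj => [|[|j]] //= mj; rewrite !subSS subn0.
by rewrite !coefP_gt ?mulr0 ?addr0// ltnW// ltnW.
Qed.

Lemma parity_quadratic_op a0 a2 m :
  has_parity (odd m) (quadratic_op a0 a2 (P m)).
Proof.
apply: (@has_parityM _ false _ _ _ _ (@has_parityP m)).
apply: has_parityD; first exact: has_parityC.
exact: (has_parityM (@has_parityC R a2) (@has_parityXn R 2)).
Qed.

(** The Leibniz rule: it moves [sigma d/dx] from one factor to the other, and
    under [L] the first term on the right disappears for the [y1], [y3] of the
    Pearson equation. *)
Lemma first_order_opM s q x1 x3 y1 y3 p r :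
  first_order_op s q x1 x3 p * r =
  first_order_op s q y1 y3 (p * r) - p * first_order_op s q (y1 - x1) (y3 - x3) r.
Proof. by rewrite /first_order_op derivM !rmorphB /=; ring. Qed.

Variables q alpha beta : R.

Local Notation t1 := (- 2 * (1 + q) - 2 * alpha - 2 * beta * q).
Local Notation t3 := (4 * q + 2 * q * (alpha + beta)).
(* [t1 x + t3 x^3] is [sigma' + sigma w' / w] for the weight
   [(1 - x^2)^alpha (1 - q x^2)^beta]. *)
Hypothesis L_pearson : forall p, L (first_order_op (1 + q) q t1 t3 p) = 0.

(** [ladder_b1] is what makes the coefficient of degree [n+1] cancel in the
    ladder relation. [ladder_a2] and [ladder_a0] come from
    [x A_n = B_(n+1) + B_n + v], which is the consistency of the relation at
    [n+1] with the relation at [n] and the recurrence. *)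
Definition ladder_a2 n := - (2 * q * (n%:R + 1 / 2 + alpha + beta)).
Definition ladder_b1 n := b n * ladder_a2 n + n%:R * (1 + q) + 2 * q * p1 n.
Definition ladder_a0 n :=
  ladder_b1 n.+1 + ladder_b1 n + 2 * alpha + 2 * beta * q.

Local Notation a0 := ladder_a0.
Local Notation a2 := ladder_a2.
Local Notation b1 := ladder_b1.

(** The difference [d] of the two sides has degree below [n.+1]: its
    coefficients at [n.+4] and [n.+2] cancel, and the others in that range
    vanish by parity. It is orthogonal to each [P m] of lower degree, since the
    Pearson equation moves the derivative to [P m]; only [m = n] and
    [m = n - 2] require a computation. *)
Lemma ladder_relationS n :
  first_order_op (1 + q) q (b1 n.+1) (- (n.+1%:R * q)) (P n.+1) =
  (b n.+1)%:P * quadratic_op (a0 n.+1) (a2 n.+1) (P n).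
Proof.
set x1 := b1 n.+1; set x3 := - _; set y0 := a0 n.+1; set y2 := a2 n.+1.
apply/eqP; rewrite -subr_eq0; apply/eqP.
set d := _ - _.
have parity_d : has_parity (odd n) d.
  apply: has_parityB.
    by have := @parity_first_order_op (1 + q) q x1 x3 n.+1; rewrite /= negbK.
  exact: (has_parityM (@has_parityC R _) (@parity_quadratic_op y0 y2 n)).
have size_d : (size d <= n.+1)%N.
  apply/leq_sizeP => j nj.
  have [jn|] := ltnP n.+4 j.
    rewrite coefB coefCM !nth_default ?mulr0 ?subr0//.
      by apply: leq_trans (size_quadratic_op _ _ _) _; rewrite ltnW// ltnW.
    exact: leq_trans (size_first_order_op _ _ _ _ _) _.
  rewrite leq_eqVlt => /predU1P[->|].
    rewrite coefB coefCM coef_first_order_op_top nth_default; last first.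
      by apply: leq_trans (size_quadratic_op _ _ _) _; rewrite ltnW.
    by rewrite /x3; ring.
  rewrite ltnS leq_eqVlt => /predU1P[->|].
    by apply: parity_d => /=; case: odd.
  rewrite ltnS leq_eqVlt => /predU1P[->|jn].
    rewrite coefB coefCM coef_first_order_op coef_quadratic_op_top.
    by rewrite /x1 /x3 /b1 /y2; ring.
  have -> : j = n.+1 by lia.
  by apply: parity_d => /=; case: odd.
apply: (orthogonal_to_low_eq0 size_d) => m mn.
have -> : d * P m =
    first_order_op (1 + q) q t1 t3 (P n.+1 * P m)
    + ((-1) *: (P n.+1 * first_order_op (1 + q) q (t1 - x1) (t3 - x3) (P m))
      + (- b n.+1) *: (P n * quadratic_op y0 y2 (P m))).
  rewrite mulrBl (@first_order_opM _ _ _ _ t1 t3) /quadratic_op -!mul_polyC.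
  by rewrite !rmorphN /=; ring.
rewrite LD L_pearson add0r LD !LZ.
have le_m_n3 : (m.+4 <= n.+4)%N by rewrite !ltnS -ltnS.
have le_m_n2 : (m.+3 <= n.+3)%N by [].
rewrite !L_orth_top; first last.
- exact: leq_trans (size_first_order_op _ _ _ _ _) _.
- exact: leq_trans (size_quadratic_op _ _ _) _.
rewrite -recurrence_coeff_norms !subleadingS.
move: mn; rewrite ltnS leq_eqVlt => /predU1P[->|].
  rewrite coef_first_order_op_top coef_first_order_op.
  rewrite coef_quadratic_op_top coef_quadratic_op.
  rewrite /x1 /x3 /y0 /y2 /a0 /a2 /b1 /a2 !subleadingS.
  by rewrite -[n.+2]addn2 -[n.+1]addn1 !natrD; field.
(* m = n - 1: every coefficient involved vanishes, by parity or by degree. *)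
rewrite leq_eqVlt => /predU1P[<-|].
  rewrite [X in _ * (X - _)](@parity_first_order_op _ _ _ _ m); last first.
    by rewrite /=; case: odd.
  rewrite [X in _ + _ * (_ * (X - _))](@parity_quadratic_op _ _ m); last first.
    by rewrite /=; case: odd.
  rewrite nth_default ?size_first_order_op// nth_default ?size_quadratic_op//.
  by ring.
(* m = n - 2: only the two leading coefficients contribute. *)
rewrite leq_eqVlt => /predU1P[nE|mn].
  rewrite -nE coef_first_order_op_top coef_quadratic_op_top.
  rewrite nth_default; last exact: leqW (size_first_order_op _ _ _ _ _).
  rewrite nth_default; last exact: leqW (size_quadratic_op _ _ _).
  by rewrite /x3 /y2 /a2 -nE -[m.+3]addn3 natrD; field.
(* m < n - 2: every coefficient involved is beyond the degree. *)
have sz1 : (size (first_order_op (1 + q) q (t1 - x1) (t3 - x3) (P m)) <= n.+1)%N.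
  exact: leq_trans (size_first_order_op _ _ _ _ _) _.
have sz2 : (size (quadratic_op y0 y2 (P m)) <= n)%N.
  exact: leq_trans (size_quadratic_op _ _ _) _.
rewrite (nth_default _ sz1) (nth_default _ sz2).
rewrite (nth_default _ (leqW (leqW sz1))) (nth_default _ (leqW (leqW sz2))).
by ring.
Qed.

Lemma ladder_relation n :
  first_order_op (1 + q) q (b1 n) (- (n%:R * q)) (P n) =
  (b n)%:P * quadratic_op (a0 n) (a2 n) (pred_poly P n).
Proof.
case: n => [|n]; last exact: ladder_relationS.
rewrite /b1 /first_order_op P_rec.1 /subleading P0E /= derivC.
by rewrite !mul0r !mulr0 !add0r oppr0 !mul0r addr0 mul0r.
Qed.

Lemma horner_first_order_op s r x1 x3 p x :
  (first_order_op s r x1 x3 p).[x] =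
  (1 - s * x ^+ 2 + r * x ^+ 4) * p^`().[x] + (x1 * x + x3 * x ^+ 3) * p.[x].
Proof. by rewrite /first_order_op !(hornerE, hornerXn); ring. Qed.

Lemma horner_quadratic_op y0 y2 p x :
  (quadratic_op y0 y2 p).[x] = (y0 + y2 * x ^+ 2) * p.[x].
Proof. by rewrite /quadratic_op !(hornerE, hornerXn). Qed.

(** [up] and [down], the ladder relation at [n.+1] and its companion, are
    homogeneous in the values of [P n.+1] and [P n] at a root [x] of [sigma],
    and one of these values is nonzero. Here [B] and [v] are the odd polynomials
    of the two relations divided by [x]. *)
Lemma ladder_compatibility_at_root n (x : R) :
  1 - (1 + q) * x ^+ 2 + q * x ^+ 4 = 0 ->
  let B := b1 n.+1 - n.+1%:R * q * x ^+ 2 in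
  let v := 2 * alpha + 2 * beta * q - 2 * q * (alpha + beta) * x ^+ 2 in
  x ^+ 2 * (B * (B + v)) =
  b n.+1 * (a0 n.+1 + a2 n.+1 * x ^+ 2) * (a0 n + a2 n * x ^+ 2).
Proof.
move=> x_root B v; set An := a0 n.+1 + _; set Am := a0 n + _.
have up : x * B * (P n.+1).[x] = b n.+1 * An * (P n).[x].
  have /(congr1 (fun p : {poly R} => p.[x])) := ladder_relationS n.
  rewrite horner_first_order_op hornerM hornerC horner_quadratic_op x_root.
  by rewrite mul0r add0r => lad; rewrite -[RHS]mulrA -lad /B; ring.
have down : Am * (P n.+1).[x] = x * (B + v) * (P n).[x].
  have /(congr1 (fun p : {poly R} => p.[x])) := ladder_relation n.
  have /(congr1 (fun p : {poly R} => p.[x])) := P_rec.2 n.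
  rewrite hornerM hornerX hornerD hornerZ => rec.
  rewrite horner_first_order_op hornerM hornerC horner_quadratic_op x_root.
  rewrite mul0r add0r => lad.
  have -> : (P n.+1).[x] = x * (P n).[x] - b n * (pred_poly P n).[x].
    by rewrite rec addrK.
  rewrite mulrBr [Am * (b n * _)]mulrCA -lad /Am /B /v /a0 /a2 -natr1.
  by field.
have [Pn0|Pn_neq0] := eqVneq (P n).[x] 0.
  apply: (mulIf (consecutive_no_common_root Pn0)).
  transitivity (x * (B + v) * (x * B * (P n.+1).[x])); first by ring.
  by rewrite up mulrCA -down; ring.
apply: (mulIf Pn_neq0).
transitivity (x * B * (x * (B + v) * (P n).[x])); first by ring.
by rewrite -down mulrCA up; ring.
Qed.

(** [x] only serves to provide the roots of [sigma] with [x^2 = 1 / q]. *)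
Lemma quadratic_relation n (x : R) : q != 1 -> q * x ^+ 2 = 1 ->
  0 = q * p1 n.+1 ^+ 2
      + (2 * q * (alpha + beta + n.+1%:R - 1 / 2) * b n.+1
         - alpha * q - beta) * p1 n.+1
      - q * (alpha + beta + n.+1%:R + 3 / 2)
          * (alpha + beta + n.+1%:R - 1 / 2) * (b n.+1) ^+ 2
      - (q * (alpha + beta + n.+1%:R + 3 / 2)
           * (alpha + beta + n.+1%:R - 1 / 2) * b n.+2
         - ((beta + n.+1%:R + 1 / 2) * q + (alpha + n.+1%:R + 1 / 2))
           * (alpha + beta + n.+1%:R - 1 / 2)
         + q * (alpha + beta + n.+1%:R + 1 / 2)
           * (alpha + beta + n.+1%:R - 3 / 2) * b n) * b n.+1
      - n.+1%:R / 2 * (n.+1%:R / 2 + alpha + beta).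
Proof.
move=> q_neq1 qx.
have q_neq0 : q != 0.
  by apply: contra_eqN qx => /eqP ->; rewrite mul0r eq_sym oner_eq0.
have x2 : x ^+ 2 = q^-1 by rewrite -[LHS](mulKf q_neq0) qx mulr1.
have root_1 : 1 - (1 + q) * 1 ^+ 2 + q * 1 ^+ 4 = 0 by ring.
have root_x : 1 - (1 + q) * x ^+ 2 + q * x ^+ 4 = 0.
  by rewrite -[4%N]/(2 * 2)%N exprM x2; field.
move: (ladder_compatibility_at_root n root_1).
move: (ladder_compatibility_at_root n root_x); rewrite x2 expr1n /=.
set lx := (X in X = _); set rx := (X in _ = X) => Ex.
set l1 := (X in X = _); set r1 := (X in _ = X) => E1.
transitivity ((lx - rx - (l1 - r1)) / (4 * (1 - q))).
  by rewrite Ex E1 !subrr mul0r.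
rewrite /lx /rx /l1 /r1 /a0 /b1 /a2 !subleadingS.
rewrite -[n.+2]addn2 -[n.+1]addn1 !natrD.
field.
by rewrite q_neq0 subr_eq0 eq_sym q_neq1.
Qed.

End OrthogonalPolynomials.

(** * The weight: integrability, positivity and the Pearson equation *)

Section Weight.
Variables (R : realType) (alpha beta k : R).
Hypothesis alpha_gtN1 : -1 < alpha.
Hypothesis k2_lt1 : k ^+ 2 < 1.

Local Notation mu := (@lebesgue_measure R).
Local Notation w := (weight alpha beta k).
Local Notation D := (`[(-1), 1]%classic : set R).

Lemma weight_ge0 x : 0 <= w x.
Proof. by rewrite mulr_ge0 ?powR_ge0. Qed.

Lemma one_sub_sqr_gt0 (x : R) : x \in `]-1, 1[ -> 0 < 1 - x ^+ 2.
Proof. by rewrite in_itv /= => /andP[? ?]; nra. Qed.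

Lemma one_sub_k2_sqr_gt0 (x : R) : x \in `[-1, 1] -> 0 < 1 - k ^+ 2 * x ^+ 2.
Proof.
rewrite in_itv /= => /andP[? ?]; rewrite subr_gt0.
by apply: le_lt_trans k2_lt1; rewrite ler_piMr ?sqr_ge0//; nra.
Qed.

Lemma weight_gt0 (x : R) : x \in `]-1, 1[ -> 0 < w x.
Proof.
move=> x11; rewrite mulr_gt0// powR_gt0 ?one_sub_sqr_gt0//.
by apply: one_sub_k2_sqr_gt0; exact: subset_itv_oo_cc x11.
Qed.

(** Both factors have the form [(1 - c x^2) `^ a], so that the analytic facts
    about that function cover the weight. *)
Lemma weightE x :
  w x = (1 - 1 * x ^+ 2) `^ alpha * (1 - k ^+ 2 * x ^+ 2) `^ beta.
Proof. by rewrite mul1r. Qed.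

Lemma measurable_powR_quadratic (c a : R) :
  measurable_fun setT (fun x : R => (1 - c * x ^+ 2) `^ a).
Proof.
change (measurable_fun setT ((@powR R) ^~ a \o (fun x : R => 1 - c * x ^+ 2))).
apply: measurableT_comp; first exact: measurable_powR.
by apply: measurable_funB => //; apply: measurable_funM => //; exact: measurable_funX.
Qed.

Lemma measurable_weight : measurable_fun setT w.
Proof.
rewrite (funext weightE).
by apply: measurable_funM; apply: measurable_powR_quadratic.
Qed.

Lemma is_derive_powR_quadratic (c a x : R) : 0 < 1 - c * x ^+ 2 ->
  is_derive x 1 (fun y => (1 - c * y ^+ 2) `^ a)
    (a * (1 - c * x ^+ 2) `^ (a - 1) * (- 2 * c * x)).
Proof.
move=> cx; have dq : is_derive x 1 (fun y => 1 - c * y ^+ 2) (- 2 * c * x).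
  by apply: is_derive_eq; rewrite /GRing.scale /=; ring.
have := @is_derive1_comp R (@powR R ^~ a) _ x _ _ (is_derive1_powR a cx) dq.
by apply.
Qed.

Lemma continuous_powR_quadratic (c a x : R) : 0 < 1 - c * x ^+ 2 ->
  {for x, continuous (fun y : R => (1 - c * y ^+ 2) `^ a)}.
Proof.
move=> cx; apply/differentiable_continuous/derivable1_diffP.
by have [] := is_derive_powR_quadratic a cx.
Qed.

Lemma is_derive_horner (p : {poly R}) (x : R) :
  is_derive x 1 (horner p) (p^`()).[x].
Proof.
by rewrite derivE derive1E; apply: DeriveDef => //; exact: derivable_horner.
Qed.

Lemma continuous_weight (x : R) : x \in `]-1, 1[ -> {for x, continuous w}.
Proof.
move=> x11; rewrite (funext weightE); apply: continuousM.
  by apply: continuous_powR_quadratic; rewrite mul1r one_sub_sqr_gt0.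
apply: continuous_powR_quadratic; apply: one_sub_k2_sqr_gt0.
exact: subset_itv_oo_cc x11.
Qed.

(** [G p] is [p sigma w] with the powers merged. The merged exponent
    [alpha + 1 > 0] makes it continuous up to the endpoints, where [w] itself
    may be unbounded. *)
Let G (p : {poly R}) (x : R) := p.[x] *
  ((1 - 1 * x ^+ 2) `^ (alpha + 1) * (1 - k ^+ 2 * x ^+ 2) `^ (beta + 1)).

Let is_derive_G (p : {poly R}) (x : R) : x \in `]-1, 1[ ->
  is_derive x 1 (G p)
   ((first_order_op (1 + k ^+ 2) (k ^+ 2)
    (- 2 * (1 + k ^+ 2) - 2 * alpha - 2 * beta * k ^+ 2)
    (4 * k ^+ 2 + 2 * k ^+ 2 * (alpha + beta)) p).[x] * w x).
Proof.
move=> x11.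
have pos1 : 0 < 1 - 1 * x ^+ 2 by rewrite mul1r one_sub_sqr_gt0.
have posk : 0 < 1 - k ^+ 2 * x ^+ 2.
  by apply: one_sub_k2_sqr_gt0; exact: subset_itv_oo_cc x11.
have d1 := is_derive_powR_quadratic (alpha + 1) pos1.
have dk := is_derive_powR_quadratic (beta + 1) posk.
have dp := is_derive_horner p x.
have d := is_deriveM dp (is_deriveM d1 dk).
apply: (is_derive_eq d).
rewrite horner_first_order_op weightE /GRing.scale /= !fctE.
rewrite !addrK !powRD ?(gt_eqF pos1) ?(gt_eqF posk) ?implybT//.
rewrite !powRr1 ?ltW//.
by ring.
Qed.

Let G_at p (x : R) : x ^+ 2 = 1 -> G p x = 0.
Proof.
move=> x2; rewrite /G x2 mulr1 subrr powR0 ?mul0r ?mulr0//.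
by rewrite gt_eqF// -ltrBlDr sub0r.
Qed.

Let G_continuous (p : {poly R}) : {within `[-1, 1], continuous (G p)}.
Proof.
have lt11 : -1 < 1 :> R by lra.
have N1_sqr : (-1) ^+ 2 = 1 :> R by rewrite sqrrN expr1n.
have one_sqr : 1 ^+ 2 = 1 :> R by rewrite expr1n.
pose u (y : R) : R := 1 - 1 * y ^+ 2.
have quad_cont (x : R) : {for x, continuous u}.
  apply/differentiable_continuous/derivable1_diffP.
  by apply: derivableB => //; apply: derivableM.
have rest_cont (x : R) : x \in `[-1, 1] -> {for x, continuous (fun y : R =>
    p.[y] * (1 - k ^+ 2 * y ^+ 2) `^ (beta + 1))}.
  move=> x11; apply: continuousM; first exact: continuous_horner.
  by apply: continuous_powR_quadratic; exact: one_sub_k2_sqr_gt0.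
have powR_at0 : (@powR R) ^~ (alpha + 1) x @[x --> 0^'+] --> 0.
  by apply: powR_cvg0; rewrite -ltrBlDr sub0r.
have GE : G p = fun y => (((@powR R) ^~ (alpha + 1)) \o u) y *
    (p.[y] * (1 - k ^+ 2 * y ^+ 2) `^ (beta + 1)).
  by apply/funext => y; rewrite /G /= mulrCA.
apply/(continuous_within_itvP _ lt11); split.
- move=> x x11; apply/differentiable_continuous/derivable1_diffP.
  by have [] := is_derive_G p x11.
- rewrite G_at// GE -(mul0r (p.[-1] * (1 - k ^+ 2 * (-1) ^+ 2) `^ (beta + 1))).
  apply: cvgM; last first.
    by apply: cvg_at_right_filter; apply: rest_cont; rewrite in_itv /=; lra.
  apply: (@increasing_cvg_at_right_comp _ u ((@powR R) ^~ (alpha + 1)) (-1)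
    (BLeft 0) 0); first by rewrite bnd_simp; lra.
  + by move=> x y; rewrite !in_itv /= /u => /andP[? ?] /andP[? ?] ?; nra.
  + by apply: cvg_at_right_filter; exact: quad_cont.
  + by rewrite /u N1_sqr mulr1 subrr.
- rewrite G_at// GE -(mul0r (p.[1] * (1 - k ^+ 2 * 1 ^+ 2) `^ (beta + 1))).
  apply: cvgM; last first.
    by apply: cvg_at_left_filter; apply: rest_cont; rewrite in_itv /=; lra.
  apply: (@decreasing_cvg_at_left_comp _ u ((@powR R) ^~ (alpha + 1))
    (BRight 0) 1 0); first by rewrite bnd_simp; lra.
  + by move=> x y; rewrite !in_itv /= /u => /andP[? ?] /andP[? ?] ?; nra.
  + by apply: cvg_at_left_filter; exact: quad_cont.
  + by rewrite /u one_sqr mulr1 subrr.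
Qed.

(** In the application integrability is not computed: it follows from the
    finiteness of the norm of the constant polynomial. *)
Hypothesis w_int : mu.-integrable D (EFin \o w).

Lemma integrable_horner_weight (p : {poly R}) :
  mu.-integrable D (EFin \o (fun x => p.[x] * w x)).
Proof.
rewrite (_ : EFin \o _ = (EFin \o horner p) \* (EFin \o w))%E; last first.
  by apply/funext => x /=; rewrite EFinM.
apply: integrableMr => //.
  apply: measurable_funS (continuous_measurable_fun (@continuous_horner R p)) => //.
have cp : {within D, continuous (horner p)}.
  by apply: continuous_subspaceT => x; exact: continuous_horner.
have /compact_bounded[M [_ Mp]] := continuous_compact cp (@segment_compact R (-1) 1).
by exists M; split; rewrite ?num_real // => r Mr x Dx; apply: Mp => //; exists x.
Qed.

Definition weighted_integral (p : {poly R}) : R :=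
  \int[mu]_(x in D) (p.[x] * w x).

Lemma weighted_integral_linear c (p q : {poly R}) :
  weighted_integral (c *: p + q) =
  c * weighted_integral p + weighted_integral q.
Proof.
have ip r := integrable_horner_weight r.
rewrite /weighted_integral -RintegralZl// -RintegralD//.
  by apply: eq_Rintegral => x _; rewrite hornerD hornerZ; ring.
exact: (integrableZl _ c (ip p)).
Qed.

Lemma finite_set_roots (p : {poly R}) : p != 0 -> finite_set [set x | root p x].
Proof.
have [n] := ubnP (size p); elim: n p => // n IH p sp p0.
have [[a pa]|noroot] := pselect (exists a, root p a); last first.
  by rewrite (_ : [set x | _] = set0)// -subset0 => x px; apply: noroot; exists x.
have /factor_theorem[q pE] := pa.
have q0 : q != 0 by apply: contra p0; rewrite pE => /eqP ->; rewrite mul0r.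
apply: (@sub_finite_set _ _ ([set a] `|` [set x | root q x])).
  by move=> x /=; rewrite pE rootM root_XsubC => /orP[qx|/eqP ->]; [right|left].
rewrite finite_setU; split=> //; apply: IH => //.
by move: sp; rewrite pE size_mul ?polyXsubC_eq0// size_XsubC addn2.
Qed.

(** If the integral were zero, the integrand would vanish almost everywhere, so
    [`]-1, 1[] would be covered by a null set and the finitely many roots of
    [p]. *)
Lemma weighted_integral_sqr_neq0 (p : {poly R}) : p != 0 ->
  weighted_integral (p * p) != 0.
Proof.
move=> p0; apply/eqP => int0.
have f_int := integrable_horner_weight (p * p).
set f := EFin \o _ in f_int.
have mf : measurable_fun D f by exact: measurable_int f_int.
have : (\int[mu]_(x in D) `|f x| = 0)%E.
  have -> : (\int[mu]_(x in D) `|f x| = \int[mu]_(x in D) f x)%E.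
    apply: eq_integral => x _.
    by rewrite gee0_abs// lee_fin mulr_ge0 ?weight_ge0// hornerM -expr2 sqr_ge0.
  rewrite -[LHS]fineK; first by rewrite [fine _]int0.
  exact: integrable_fin_num.
move/ae_eq_integral_abs => /(_ _ mf)[//|N [mN N0 fN]].
have roots0 : mu [set x | root p x] = 0%E.
  by apply: countable_lebesgue_measure0; exact/finite_set_countable/finite_set_roots.
have mroots : measurable [set x | root p x].
  apply: countable_measurable; first exact: measurable_set1.
  exact/finite_set_countable/finite_set_roots.
pose I : set R := `]-1, 1[%classic.
have I_sub : I `<=` N `|` [set x | root p x].
  move=> x x11; have [px|px] := boolP (root p x); first by right.
  left; apply: fN => /= /(_ (subset_itv_oo_cc x11)) [] /eqP.
  apply/negP/mulf_neq0; first by rewrite hornerM mulf_neq0.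
  by rewrite gt_eqF//; exact: weight_gt0.
have mI : measurable I by exact: measurable_itv.
have muI : mu I = (1 - (-1))%:E.
  by rewrite /I lebesgue_measure_itv /= lte_fin ifT// -?EFinB//; lra.
have : (mu I <= mu (N `|` [set x | root p x]))%E.
  by apply: le_measure; rewrite ?inE//; exact: measurableU.
rewrite muI measureU0//.
rewrite [X in (_ <= X)%E](_ : _ = 0%E)//.
by rewrite lee_fin; lra.
Qed.

(** For [alpha < 0] the integrand can be unbounded near the endpoints, so the
    fundamental theorem of calculus gives derivatives only in the open interval.
    Since the indefinite integral [F] and [G p] are continuous on the closed
    interval and have the same derivative inside, [F - G p] is constant there. *)
Lemma weighted_integral_pearson p :
  weighted_integral (first_order_op (1 + k ^+ 2) (k ^+ 2)
    (- 2 * (1 + k ^+ 2) - 2 * alpha - 2 * beta * k ^+ 2)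
    (4 * k ^+ 2 + 2 * k ^+ 2 * (alpha + beta)) p) = 0.
Proof.
set r := first_order_op _ _ _ _ _.
have r_int := integrable_horner_weight r.
pose F (x : R) := \int[mu]_(t in `[-1, x]) (r.[t] * w t).
have F_cont : {within `[-1, 1], continuous F}.
  by apply: parameterized_integral_continuous => //; lra.
have F_der (x : R) : x \in `]-1, 1[ -> is_derive x 1 F (r.[x] * w x).
  move=> x11; have := x11; rewrite in_itv /= => /andP[x_gt x_lt].
  have cont : {for x, continuous (fun t => r.[t] * w t)}.
    apply: continuousM; first exact: continuous_horner.
    exact: continuous_weight.
  have [dF F'] := continuous_FTC1_closed x_lt r_int x_gt cont.
  by apply: DeriveDef => //; rewrite -derive1E.
have H_der (x : R) : x \in `]-1, 1[ -> is_derive x 1 (F - G p) 0.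
  move=> x11; have := is_deriveB (F_der x x11) (is_derive_G p x11).
  by rewrite subrr.
have H_cont : {within `[-1, 1], continuous (F - G p)}.
  by move=> x; apply: continuousB; [exact: F_cont|exact: G_continuous].
have lt11 : -1 < 1 :> R by lra.
have [c _] := MVT lt11 H_der H_cont.
rewrite mul0r !fctE !G_at ?sqrrN ?expr1n// !subr0 => /eqP; rewrite subr_eq0 => /eqP.
rewrite /weighted_integral -/(F 1) => ->.
by rewrite /F set_itv1 Rintegral_set1.
Qed.

End Weight.

(** * The quadratic relation *)

Theorem theorem1p1 (R : realType) (alpha beta k : R)
    (P : nat -> {poly R}) (h b : nat -> R)
    (halpha : -1 < alpha) (hk : 0 < k ^+ 2 < 1)
    (hP : monic_orthogonal (weight alpha beta k) P h)
    (hb : recurrence_coeffs P b)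
    (n : nat) (hn : (1 <= n)%N) :
  0 = k ^+ 2 * (subleading P n) ^+ 2
      + (2 * k ^+ 2 * (alpha + beta + n%:R - 1 / 2) * b n
         - alpha * k ^+ 2 - beta) * subleading P n
      - k ^+ 2 * (alpha + beta + n%:R + 3 / 2)
          * (alpha + beta + n%:R - 1 / 2) * (b n) ^+ 2
      - (k ^+ 2 * (alpha + beta + n%:R + 3 / 2)
           * (alpha + beta + n%:R - 1 / 2) * b n.+1
         - ((beta + n%:R + 1 / 2) * k ^+ 2 + (alpha + n%:R + 1 / 2))
           * (alpha + beta + n%:R - 1 / 2)
         + k ^+ 2 * (alpha + beta + n%:R + 1 / 2)
           * (alpha + beta + n%:R - 3 / 2) * b n.-1) * b n
      - n%:R / 2 * (n%:R / 2 + alpha + beta).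
Proof.
have /andP[k2_gt0 k2_lt1] := hk; have [P_monic_size P_int] := hP.
have P_monic m : P m \is monic by have [] := P_monic_size m.
have P_size m : size (P m) = m.+1 by have [] := P_monic_size m.
have w_int : (@lebesgue_measure R).-integrable `[-1, 1]
    (EFin \o weight alpha beta k).
  apply/integrableP; split.
    by apply/measurable_EFinP; apply: measurable_funS (measurable_weight _ _ _).
  have := P_int 0%N 0%N; rewrite (P0E P_monic P_size) => int_w.
  rewrite (_ : (\int[_]_(x in _) _)%E = (h 0%N * (0%N == 0%N)%:R)%:E) ?ltry//.
  rewrite -int_w; apply: eq_integral => x _.
  by rewrite !hornerC !mul1r /= ger0_norm ?weight_ge0.
have P_orth i j : weighted_integral alpha beta k (P i * P j) = h j * (i == j)%:R.
  rewrite /weighted_integral /Rintegral.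
  under eq_integral do rewrite hornerM.
  by rewrite P_int.
have h_neq0 m : h m != 0.
  have := P_orth m m; rewrite eqxx mulr1 => <-.
  apply: (weighted_integral_sqr_neq0 k2_lt1 w_int).
  by rewrite -size_poly_eq0 P_size.
have k_neq0 : k != 0 by rewrite -sqrf_eq0 gt_eqF.
case: n hn => // n _; rewrite /=.
apply: (quadratic_relation (weighted_integral_linear w_int) P_monic P_size P_orth
  h_neq0 hb _ _ (x := k^-1)).
- by move=> p; apply: weighted_integral_pearson.
- by rewrite lt_eqF.
- by rewrite -exprMn mulfV ?expr1n.
Qed.
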